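(* Let $n>1$ be an integer all of whose components are congruent to $3$ modulo $4$ and distinct from $3$, and let $G$ be a pertinent group of order divisible by $4$ admitting a pseudo-resolvable $(G,\Sigma,3,1)$ difference family. Then there exists a $(G\times V_n,G\times\{0\},3,1)$ difference family which is $J$-resolvable for some subgroup $J$ of order $2$ of $G\times\{0\}$ and which admits a group of strong multipliers whose order is the greatest odd divisor of $\psi(n)$.
   Context: A component of an integer is a maximal prime power dividing it. For $N$ with components $q_1,\dots,q_\omega$, $\mathbb F_N=\mathbb F_{q_1}\times\dots\times\mathbb F_{q_\omega}$, $V_N$ is its additive group, $\psi(N)=\prod_i(q_i-1)$. Groups are written additively, $x-y:=x+(-y)$. A finite group is pertinent if it has exactly three involutions and they are pairwise conjugate. For a family $\mathcal F$ of $3$-subsets of a group $G$, $\Delta\mathcal F$ is the multiset of all $x-y$ with $x\ne y$ in a common block, and $\Phi(\mathcal F)$ the multiset union of the blocks. For a set $\Sigma$ of subgroups with pairwise trivial intersections, a $(G,\Sigma,3,1)$ difference family is a family $\mathcal F$ with $\Delta\mathcal F$ equal (each element once) to the set of elements of $G$ in no member of $\Sigma$; for a subgroup $H$, a $(G,H,3,1)$ difference family is one with $\Sigma=\{H\}$. If $G$ is pertinent of order divisible by $4$ with involutions $j_1,j_2,j_3$, a $(G,\Sigma,3,1)$ difference family with $\Sigma=\{\{0,j_1\},\{0,j_2\},\{0,j_3\},\{0,x,-x\}\}$ ($x$ of order $3$) is pseudo-resolvable if $\Phi(\mathcal F)\cup\{0,j_\alpha,x\}$ is a complete system of representatives for the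 left cosets of $\{0,j_\beta\}$ in $G$ for suitable involutions $j_\alpha,j_\beta$. For $J\le H$ of order $2$, a $(G,H,3,1)$ difference family is $J$-resolvable if $\Phi(\mathcal F)$ is a complete system of representatives for the left cosets of $J$ not contained in $H$. A strong multiplier is an automorphism of the group fixing $H$ elementwise and mapping the set of blocks onto itself. *)

(* Defs.v *)
From HB Require Import structures.
From mathcomp Require Import all_boot all_order all_fingroup all_algebra.
From mathcomp Require Import all_solvable all_field.

Set Implicit Arguments.
Unset Strict Implicit.
Unset Printing Implicit Defensive.

Import GroupScope.

(* All groups are multiplicative here: 0, x + y, -x and x - y of the additive
   notation read 1, x * y, x^-1 and x * y^-1; a left coset g + J is g *: J. *)

Section Components.
Variable n : nat.

(* For p in primes n, n`_p = p ^ logn p n is the maximal power of p that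
   divides n. *)
Definition components : seq nat := [seq (n`_p)%N | p : nat <- primes n].

Definition psi : nat := (\prod_(q <- components) (q - 1))%N.

Definition comp_prime (i : 'I_(size (primes n))) : nat := nth 0 (primes n) i.

Lemma comp_primeP i : prime (comp_prime i).
Proof.
by have := mem_nth 0 (ltn_ord i); rewrite mem_primes => /andP[].
Qed.

Lemma comp_logn_gt0 i : 0 < logn (comp_prime i) n.
Proof. by rewrite logn_gt0; apply: mem_nth. Qed.

Definition comp_field (i : 'I_(size (primes n))) : finFieldType :=
  s2val (pPrimePowerField (comp_primeP i) (comp_logn_gt0 i)).

Lemma card_comp_field i : #|comp_field i| = (n`_(comp_prime i))%N.
Proof. by rewrite p_part; rewrite /comp_field; case: pPrimePowerField. Qed.

(* The additive group of the product of the fields comp_field i: the group law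
   on a finite field is its addition. *)
Definition V : finGroupType := {dffun forall i, comp_field i}.

End Components.

Definition greatest_odd_divisor (m : nat) : nat :=
  \max_(d <- divisors m | odd d) d.

Section DifferenceFamilies.
Variable gT : finGroupType.
Implicit Types (F : seq {set gT}) (s : seq gT) (H J : {group gT}) (x j : gT).

Definition involutions : {set gT} := [set j | #[j] == 2].

Definition pertinent : Prop :=
  #|involutions| = 3 /\
  {in involutions &, forall j k, k \in j ^: [set: gT]}.

Definition Delta F : seq gT :=
  flatten [seq [seq u.1 * u.2^-1 | u <- enum (setX B B) & u.1 != u.2]
          | B : {set gT} <- F].

Definition Phi F : seq gT := flatten [seq enum B | B : {set gT} <- F].

Definition diff_family (Sigma : {set {group gT}}) F : Prop :=
  [/\ {in Sigma &, forall H K : {group gT}, H != K -> H :&: K = 1},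
      {in F, forall B : {set gT}, #|B| = 3}
    & perm_eq (Delta F) (enum [set g | [forall H in Sigma, g \notin H]])].

(* The multiset s (a sequence, up to order) lies in the union of the pairwise
   disjoint sets in P and meets each of them once, with multiplicity. *)
Definition complete_representatives (P : {set {set gT}}) s : Prop :=
  {subset s <= cover P} /\ {in P, forall C : {set gT}, count (mem C) s = 1%N}.

(* <[j]> is {0, j} for j an involution and <[x]> is {0, x, -x} for x of
   order 3. *)
Definition pseudo_Sigma x : {set {group gT}} :=
  <[x]>%G |: [set <[j]>%G | j in involutions].

Definition pseudo_resolvable x F : Prop :=
  exists ja jb, [/\ ja \in involutions, jb \in involutions
    & complete_representatives (lcosets <[jb]> [set: gT])
        (Phi F ++ [:: 1; ja; x])].

Definition resolvable H J F : Prop :=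
  complete_representatives
    [set C in lcosets J [set: gT] | ~~ (C \subset H)] (Phi F).

Definition strong_multiplier H F (a : {perm gT}) : Prop :=
  [/\ a \in Aut [set: gT],
      {in H, forall h, a h = h}
    & [set a @: (B : {set gT}) | B in F] = [set B in F]].

End DifferenceFamilies.

(* Main.v *)
(* Write V additively.  In every component field pick s distinct from 0, 1, -1
   and put c := s + 1/s.  Then 2, c, 2 + c, 2 - c are units of the ring V, and
   2 + c = - r^2 (2 - c) with r = (s + 1) / (s - 1).  Let R be the set of the
   nonzero z in V whose first nonzero coordinate is a square; since -1 is not a
   square, V - 0 is the disjoint union of R and -R, and R is invariant under
   componentwise multiplication by nonzero squares.  The blocks are
     {(a, 2z), (b, cz), (d, -cz)}      {a, b, d} in F0, z in V - 0,
     {(0, 2z), (x, cz), (x, -cz)}      z in R,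
     {(0, -2z), (ja, cz), (ja + jb, -cz)}      z in R.
   The first kind has differences (g, v) with g outside the members of Sigma,
   the second those with g = 0, x, -x, and the third those with g an involution;
   the three involutions commute because 4 divides the order of G.  The family
   is resolvable for J generated by (jb, 0). *)

Require Import Defs.
From mathcomp Require Import all_boot all_order all_fingroup all_algebra.
From mathcomp Require Import all_solvable all_field zify ring.

Set Implicit Arguments.
Unset Strict Implicit.
Unset Printing Implicit Defensive.

Import GroupScope GRing.Theory.

(** * Involutions of a pertinent group whose order is divisible by 4 *)

Section Involutions.
Variable gT : finGroupType.
Implicit Types j k : gT.

Lemma involutionP j : reflect (j != 1 /\ j * j = 1) (j \in involutions gT).
Proof.
rewrite inE; apply: (iffP eqP) => [oj | [j1 jj]].
  split; last by have := expg_order j; rewrite oj expgS expg1.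
  by rewrite -order_eq1 oj.
by apply: nt_prime_order; rewrite // expgS expg1.
Qed.

Lemma involution_inv j : j \in involutions gT -> j^-1 = j.
Proof. by case/involutionP=> _ jj; apply/eqP; rewrite eq_invg_mul jj. Qed.

Lemma involution_conj j k : (j ^ k \in involutions gT) = (j \in involutions gT).
Proof. by rewrite !inE orderJ. Qed.

(* The centralizer of j has index 3, and in it the centralizer of k has index
   at most 2, so some involution centralizes both j and k. *)
Lemma pertinent_commute j k : pertinent gT -> 4 %| #|gT| ->
  j \in involutions gT -> k \in involutions gT -> commute j k.
Proof.
move=> [inv3 conj_inv] dvd4 jI kI.
have [->|neq_jk] := eqVneq j k; first exact: commute_refl.
have dvd4C : 4 %| #|'C[j]|.
  have classj : #|j ^: [set: gT]| = 3.
    rewrite -inv3; apply: eq_card => y; apply/idP/idP => [/imsetP[z _ ->]|yI].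
      by rewrite involution_conj.
    exact: conj_inv.
  have := Lagrange (subsetIl [set: gT] 'C[j]).
  rewrite index_cent1 classj cardsT /= setTI => defG.
  by move: dvd4; rewrite -defG Gauss_dvdl.
have card_class : #|k ^: 'C[j]| <= 2.
  have sub : k ^: 'C[j] \subset involutions gT :\ j.
    apply/subsetP=> y /imsetP[z /cent1P cjz ->].
    rewrite inE involution_conj kI andbT inE.
    apply: contraNneq neq_jk => eqj; apply/eqP/(conjg_inj z).
    by rewrite eqj conjgE -cjz mulKg.
  by rewrite -ltnS -inv3 (cardsD1 j) jI ltnS subset_leq_card.
have [i iC oi] : {i | i \in 'C_('C[j])[k] & #[i] = 2}.
  apply: Cauchy => //.
  have := Lagrange (subsetIl 'C[j] 'C[k]); rewrite index_cent1 => defC.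
  move: card_class dvd4C (cardG_gt0 'C[j]); rewrite -defC.
  by case: #|k ^: _| => [|[|[|m]]] // _; lia.
have iI : i \in involutions gT by rewrite inE oi.
case/setIP: iC => /cent1P cij /cent1P cik.
have [<-|neq_ij] := eqVneq i j; first exact/commute_sym.
have [<-|neq_ik] := eqVneq i k; first by [].
(* Now [i], [j], [k] are all the involutions and conjugation by [k] permutes them. It fixes [i] and
   [k], hence also [j]. *)
have: j ^ k \in [set i; j; k].
  suff -> : [set i; j; k] = involutions gT by rewrite involution_conj.
  apply/eqP; rewrite eqEcard inv3 -setUA cardsU1 cards2 !inE.
  rewrite (negbTE neq_ij) (negbTE neq_ik) neq_jk andbT.
  apply/subsetP=> y; move: iI jI kI; rewrite !inE => ? ? ?.
  by case/or3P=> /eqP->.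
rewrite !inE => /orP[/orP[]|] /eqP jk.
- case/eqP: neq_ij; apply: (conjg_inj k); rewrite jk.
  by rewrite conjgE cik mulKg.
- by apply/commgP/conjg_fixP.
- by case/eqP: neq_jk; apply: (conjg_inj k); rewrite jk conjgE mulKg.
Qed.

(** The product of two distinct commuting involutions is an involution different from both, so it
    must be the third one. *)
Lemma pertinent_involutions j k : pertinent gT -> 4 %| #|gT| ->
    j \in involutions gT -> k \in involutions gT -> j != k ->
  [/\ j * k = k * j, j * k \in involutions gT
    & involutions gT = [set j; k; j * k]].
Proof.
move=> pG dvd4 jI kI neq_jk.
have cjk : commute j k by exact: pertinent_commute.
have [[j1 jj] [k1 kk]] := (involutionP _ jI, involutionP _ kI).
have jkI : j * k \in involutions gT.
  apply/involutionP; split.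
    by apply: contraNneq neq_jk => /eqP; rewrite -eq_invg_mul involution_inv.
  by rewrite {1}cjk mulgA -(mulgA k) jj mulg1 kk.
split=> //; apply/esym/eqP; rewrite eqEcard pG.1 setUC cardsU1 cards2 !inE.
have njk : j * k != j.
  by apply: contraNneq k1 => jk; apply/eqP/(mulgI j); rewrite jk mulg1.
have nkj : j * k != k.
  by apply: contraNneq j1 => jk; apply/eqP/(mulIg k); rewrite jk mul1g.
rewrite neq_jk (negbTE njk) (negbTE nkj) andbT.
by apply/subsetP=> y; move: jI kI jkI; rewrite !inE => ? ? ? /or3P[] /eqP->.
Qed.

End Involutions.

(** * Blocks as ordered triples: counting differences and points *)

Section Triples.
Variable gT : finGroupType.
Implicit Types (p : gT * gT * gT) (g : gT).

(** Ordering the points of a block makes its six differences an explicit list, so that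
    multiplicities become sums over triples; [block] forgets the order. *)
Definition points p : seq gT := [:: p.1.1; p.1.2; p.2].

Definition block p : {set gT} := [set y in points p].

Definition differences p : seq gT :=
  [:: p.1.1 * p.1.2^-1; p.1.1 * p.2^-1; p.1.2 * p.1.1^-1; p.1.2 * p.2^-1;
      p.2 * p.1.1^-1; p.2 * p.1.2^-1].

Lemma card_block p : uniq (points p) -> #|block p| = 3.
Proof. by move=> Up; rewrite cardsE; apply/card_uniqP. Qed.

Lemma enum_block p : uniq (points p) -> perm_eq (enum (block p)) (points p).
Proof.
move=> Up; apply: uniq_perm => //; first exact: enum_uniq.
by move=> y; rewrite mem_enum inE.
Qed.

Lemma perm_block_differences p : uniq (points p) ->
  perm_eq [seq u.1 * u.2^-1 | u <- enum (setX (block p) (block p)) & u.1 != u.2]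
          (differences p).
Proof.
case: p => [[a b] c] Up.
have -> : differences (a, b, c) = [seq u.1 * u.2^-1 |
    u <- [seq (y, z) | y <- [:: a; b; c], z <- [:: a; b; c]] & u.1 != u.2].
  move: Up; rewrite /= !inE !negb_or eqxx -!andbA andbT => /and3P[ab ac bc].
  by rewrite ?(eq_sym c) (eq_sym b a) !eqxx ab ac bc.
apply/perm_map/perm_filter/uniq_perm; first exact: enum_uniq.
  by apply: allpairs_uniq => // -[? ?] [? ?].
move=> [y z]; rewrite mem_enum in_setX !in_set; apply/andP/allpairsP.
  by case=> yp zp; exists (y, z).
by case=> -[y' z'] [/= yp zp [-> ->]].
Qed.

Lemma count_Delta (T : seq (gT * gT * gT)) g :
    {in T, forall p, uniq (points p)} ->
  count_mem g (Delta (map block T)) =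
    (\sum_(p <- T) count_mem g (differences p))%N.
Proof.
move=> UT; rewrite /Delta count_flatten -!map_comp sumnE big_map.
rewrite big_seq [RHS]big_seq; apply: eq_bigr => p /UT Up /=.
by have /seq.permP-> := perm_block_differences Up.
Qed.

Lemma count_Phi (T : seq (gT * gT * gT)) (a : pred gT) :
    {in T, forall p, uniq (points p)} ->
  count a (Phi (map block T)) = (\sum_(p <- T) count a (points p))%N.
Proof.
move=> UT; rewrite /Phi count_flatten -!map_comp sumnE big_map.
rewrite big_seq [RHS]big_seq; apply: eq_bigr => p /UT Up /=.
by have /seq.permP-> := enum_block Up.
Qed.

Lemma block_family (F : seq {set gT}) : {in F, forall B : {set gT}, #|B| = 3} ->
  exists2 T : seq (gT * gT * gT),
    F = map block T & {in T, forall p, uniq (points p)}.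
Proof.
move=> F3.
(* The default [1] is never returned for a block of [F], since such a block has three elements. *)
pose e (B : {set gT}) := let s := enum B in (nth 1 s 0, nth 1 s 1, nth 1 s 2).
have pts B : B \in F -> points (e B) = enum B.
  by move/F3; rewrite cardE /e; case: (enum B) => [|a [|b [|c []]]].
exists (map e F); last first.
  by move=> p /mapP[B /pts + ->] => ->; apply: enum_uniq.
rewrite -map_comp -{1}[F]map_id; apply/eq_in_map => B BF /=.
by rewrite /block pts //; apply/setP => y; rewrite inE mem_enum.
Qed.

End Triples.

Lemma count_lcoset2 (hT : finGroupType) (j g : hT) (s : seq hT) : #[j] = 2 ->
  count (mem (g *: <[j]>)) s = (count_mem g s + count_mem (g * j)%g s)%N.
Proof.
move=> j2; rewrite -count_predUI.
rewrite (@eq_count _ (predI _ _) pred0) ?count_pred0 ?addn0 => [|y /=].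
  apply: eq_count => y /=.
  rewrite mem_lcoset cycle2g // !inE -(inj_eq (mulgI g)) mulKVg mulg1.
  by rewrite -[_ == j](inj_eq (mulgI g)) mulKVg.
apply/negP=> /andP[/eqP-> /eqP gj].
have /mulgI j1 : g * 1 = g * j by rewrite mulg1.
by rewrite -j1 order1 in j2.
Qed.

(** * Counting solutions of [f z = v] for an injective endomorphism [f] *)

Section Hits.
Variable W : finGroupType.
Implicit Types (A R : {set W}) (v y : W) (f : W -> W).

Lemma eqg_invC (u v : W) : (u == v^-1) = (u^-1 == v).
Proof. by rewrite -[v in RHS]invgK (inj_eq invg_inj). Qed.

Lemma morphV f : {morph f : u v / u * v} -> {morph f : u / u^-1}.
Proof.
move=> fM u; have f1 : f 1 = 1 by apply: (mulgI (f 1)); rewrite -fM !mulg1.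
by apply: (mulgI (f u)); rewrite -fM !mulgV.
Qed.

Lemma sum_eq_mem A y : (\sum_(z in A) (z == y))%N = (y \in A).
Proof.
have [yA|yA] := boolP (y \in A).
  by rewrite (bigD1 y) //= eqxx big1 // => z /andP[_ /negbTE->].
by rewrite big1 // => z zA; case: eqVneq => // eq_zy; rewrite -eq_zy zA in yA.
Qed.

Section Injective.
Variable f : W -> W.
Hypotheses (f_inj : injective f) (fM : {morph f : y z / y * z}).

Lemma sum_hits A v : (\sum_(z in A) (f z == v))%N = (invF f_inj v \in A).
Proof.
rewrite -sum_eq_mem; apply: eq_bigr => z _; congr nat_of_bool.
by rewrite -[z == _](inj_eq f_inj) f_invF.
Qed.

Lemma morph_eq1 v : (f v == 1) = (v == 1).
Proof.
have f1 : f 1 = 1 by apply: (mulgI (f 1)); rewrite -fM !mulg1.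
by rewrite -{1}f1 (inj_eq f_inj).
Qed.

Lemma sum_hits_nontrivial v : (\sum_(z in [set~ 1%g]) (f z == v))%N = (v != 1).
Proof. by rewrite sum_hits !inE -[v in RHS](f_invF f_inj) morph_eq1. Qed.

Lemma sum_hitsV_nontrivial v :
  (\sum_(z in [set~ 1%g]) ((f z)^-1 == v))%N = (v != 1).
Proof.
rewrite -[in RHS](inj_eq invg_inj) invg1 -sum_hits_nontrivial.
by apply: eq_bigr => z _; rewrite eqg_invC.
Qed.

(** The preimages of [v] and [v^-1] under [f] are inverse to each other, and [R] contains exactly
    one of any two inverse nontrivial elements. *)
Lemma sum_hits_half R v : (forall y, (y \in R) + (y^-1 \in R) = (y != 1%g))%N ->
  (\sum_(z in R) (f z == v) + \sum_(z in R) ((f z)^-1 == v))%N = (v != 1).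
Proof.
move=> R_half; rewrite sum_hits.
have -> : (\sum_(z in R) ((f z)^-1 == v) = \sum_(z in R) (f z == v^-1))%N.
  by apply: eq_bigr => z _; rewrite eqg_invC.
rewrite sum_hits -[v in RHS](f_invF f_inj) morph_eq1 -R_half.
congr (_ + nat_of_bool (_ \in R))%N; apply: f_inj; rewrite f_invF.
apply: (mulgI v); rewrite mulgV -{1}(f_invF f_inj v) -fM mulgV.
by apply/esym/eqP; rewrite morph_eq1.
Qed.

End Injective.
End Hits.

(** Bookkeeping for the count of a difference [(g, v)]. [N] is 1 if [v] is nontrivial and 0
    otherwise, and [S] counts [g] among the differences of [T0]. The indicators [b1] to [b6] stand
    for [g] being [x^-1], [x], [1], [ja], [jb], [ja * jb]. The numbers [d], [a], [t] count the [z]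
    in [R] at which [e0 z * (e1 z)^-1], [e0 z * e1 z], [e1 z * e1 z] equals [v]; a suffix [V] means
    that the inverse equals [v], a prime that [v] is replaced by [v^-1]. *)
Lemma sum_Delta_arith (N S b1 b2 b3 b4 b5 b6 d a d' a' t dV aV tV : nat) :
    (d + dV = N -> a + aV = N -> t + tV = N -> d + a = N -> d' + a' = N ->
  N * S + (b1 * d + (b1 * a + (b2 * d' + (b3 * t + (b2 * a' + b3 * tV)))) +
    (b4 * aV + (b6 * dV + (b4 * a + (b5 * t + (b6 * d + b5 * tV)))))) =
  N * (S + b2 + b1 + b3 + b4 + b5 + b6))%N.
Proof. nia. Qed.

(** Bookkeeping for the count of a point [(h, v)]: [b1] to [b4] indicate that [h] is [1], [x], [ja],
    [ja * jb], and [z0], [z1] count the [z] in [R] with [e0 z = v], [e1 z = v]. The last two terms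
    remain, as [ja] and [ja * jb] each occur with only half of the nontrivial second coordinates. *)
Lemma sum_Phi_arith (N S b1 b2 b3 b4 z0 z1 z0V z1V : nat) :
    (z0 + z0V = N -> z1 + z1V = N ->
  N * S + (b1 * z0 + (b2 * z1 + b2 * z1V) +
    (b1 * z0V + (b3 * z1 + b4 * z1V))) =
  N * (S + b1 + b2) + b3 * z1 + b4 * z1V)%N.
Proof. nia. Qed.

Lemma coset_Phi_arith (N c o p y c' o' p' y' z zV : nat) : (z + zV = N ->
  N * (c + o + y) + p * z + p' * zV + (N * (c' + o' + y') + p' * z + p * zV) =
  N * (c + (o + (p + (y + 0))) + (c' + (o' + (p' + (y' + 0))))))%N.
Proof. nia. Qed.

(** * The lifted triples over an abstract abelian group [W], and their counts *)

Section Lift.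
Variables (gT W : finGroupType) (T0 : seq (gT * gT * gT)) (x ja jb : gT).
Variables (R : {set W}) (e0 e1 : W -> W).
Hypotheses (U0 : {in T0, forall p, uniq (points p)}) (x1 : x != 1).
Hypotheses (ja1 : ja != 1) (jb1 : jb != 1) (jajb1 : ja * jb != 1).
Hypotheses (jaV : ja^-1 = ja) (jbV : jb^-1 = jb) (cjab : ja * jb = jb * ja).
Hypothesis cW : forall u v : W, u * v = v * u.
Hypotheses (e0M : {morph e0 : u v / u * v}) (e1M : {morph e1 : u v / u * v}).
Hypotheses (e0_inj : injective e0) (e1_inj : injective e1).
Hypothesis add_inj : injective (fun z => e0 z * e1 z).
Hypothesis sub_inj : injective (fun z => e0 z * (e1 z)^-1).
Hypothesis dbl_inj : injective (fun z => e1 z * e1 z).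
Hypothesis R_half : forall v, ((v \in R) + (v^-1 \in R) = (v != 1%g))%N.
(** Needed for first coordinate [x] or [x^-1]: not being self-inverse, each receives differences of
    both shapes [e0 z * (e1 z)^-1] and [e0 z * e1 z], or of their inverses, for [z] in [R] only. *)
Hypothesis R_cross : forall v, (\sum_(z in R) (e0 z * (e1 z)^-1 == v)%g +
  \sum_(z in R) (e0 z * e1 z == v)%g = (v != 1%g))%N.

Definition lift_block (p : gT * gT * gT) (z : W) :=
  ((p.1.1, e0 z), (p.1.2, e1 z), (p.2, (e1 z)^-1)).
Definition lift_order3 (z : W) := ((1 : gT, e0 z), (x, e1 z), (x, (e1 z)^-1)).
Definition lift_klein (z : W) :=
  ((1 : gT, (e0 z)^-1), (ja, e1 z), (ja * jb, (e1 z)^-1)).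

Definition lifted : seq ((gT * W) * (gT * W) * (gT * W)) :=
  [seq lift_block p z | p <- T0, z <- enum [set~ 1%g : W]] ++
  [seq lift_order3 z | z <- enum R] ++ [seq lift_klein z | z <- enum R].

Lemma big_lifted (f : (gT * W) * (gT * W) * (gT * W) -> nat) :
  (\sum_(p <- lifted) f p =
     \sum_(p <- T0) \sum_(z in [set~ 1%g : W]) f (lift_block p z) +
     (\sum_(z in R) f (lift_order3 z) + \sum_(z in R) f (lift_klein z)))%N.
Proof.
rewrite !big_cat !big_map big_allpairs_dep !big_enum /=; congr (_ + _)%N.
by apply: eq_bigr => p _; rewrite big_enum.
Qed.

Lemma one_notin_R : 1 \notin R.
Proof. by have := R_half 1; rewrite invg1 eqxx; case: (1 \in R). Qed.

Lemma mulgACA (a b c d : W) : a * b * (c * d) = a * c * (b * d).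
Proof. by rewrite -!mulgA; congr (_ * _); rewrite !mulgA (cW b). Qed.

Lemma dblM : {morph (fun z => e1 z * e1 z) : u v / u * v}.
Proof. by move=> u v /=; rewrite e1M mulgACA. Qed.

Lemma addM : {morph (fun z => e0 z * e1 z) : u v / u * v}.
Proof. by move=> u v /=; rewrite e0M e1M mulgACA. Qed.

Lemma subM : {morph (fun z => e0 z * (e1 z)^-1) : u v / u * v}.
Proof.
by move=> u v /=; rewrite e0M e1M cW invMg cW mulgACA (cW _ (e1 u)^-1).
Qed.

Lemma uniq_lifted : {in lifted, forall p, uniq (points p)}.
Proof.
move=> p; rewrite !mem_cat => /or3P[/allpairsP[[q z] [/= /U0 Uq _ ->]]||].
- move: Uq; rewrite /= !inE !xpair_eqE; case: (q.1.1 == _) => //=.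
  by case: (q.1.1 == _) => //=; case: (q.1.2 == _).
- case/mapP=> z; rewrite mem_enum => zR ->; rewrite /= !inE !xpair_eqE.
  rewrite !(eq_sym 1 x) (negbTE x1) eqxx /= andbT.
  (* The two points over [x] coincide only if [e1 z * e1 z] is trivial, that is, if [z = 1], which
     is not in [R]. *)
  rewrite eq_sym eq_invg_mul (morph_eq1 dbl_inj dblM).
  by apply: contraNneq one_notin_R => <-.
- case/mapP=> z _ ->; rewrite /= !inE !xpair_eqE.
  rewrite !(eq_sym 1) (negbTE ja1) (negbTE jajb1) /= andbT negb_and; apply/orP; left.
  by apply: contraNneq jb1 => eqj; apply/eqP/(mulgI ja); rewrite -eqj mulg1.
Qed.

Lemma count_differences (a b c g : gT) (u w t v : W) :
  count_mem (g, v) (differences ((a, u), (b, w), (c, t))) =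
  ((a * b^-1 == g)%g * (u * w^-1 == v)%g + ((a * c^-1 == g)%g * (u * t^-1 == v)%g +
  ((b * a^-1 == g)%g * (w * u^-1 == v)%g + ((b * c^-1 == g)%g * (w * t^-1 == v)%g +
  ((c * a^-1 == g)%g * (t * u^-1 == v)%g + (c * b^-1 == g)%g * (t * w^-1 == v)%g)))))%N.
Proof. by rewrite /= !xpair_eqE !mulnb addn0. Qed.

Lemma count_points (a b c g : gT) (u w t v : W) :
  count_mem (g, v) (points ((a, u), (b, w), (c, t))) =
  ((a == g)%g * (u == v)%g + ((b == g)%g * (w == v)%g + (c == g)%g * (t == v)%g))%N.
Proof. by rewrite /= !xpair_eqE !mulnb addn0. Qed.

Lemma count_differences_block p z g v :
  count_mem (g, v) (differences (lift_block p z)) =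
  ((p.1.1 * p.1.2^-1 == g)%g * (e0 z * (e1 z)^-1 == v)%g +
  ((p.1.1 * p.2^-1 == g)%g * (e0 z * e1 z == v)%g +
  ((p.1.2 * p.1.1^-1 == g)%g * ((e0 z * (e1 z)^-1)^-1 == v)%g +
  ((p.1.2 * p.2^-1 == g)%g * (e1 z * e1 z == v)%g +
  ((p.2 * p.1.1^-1 == g)%g * ((e0 z * e1 z)^-1 == v)%g +
  (p.2 * p.1.2^-1 == g)%g * ((e1 z * e1 z)^-1 == v)%g)))))%N.
Proof. by rewrite count_differences !invMg !invgK. Qed.

(** The terms at [x] are phrased as hits of [v^-1] so that [R_cross] applies to them as it does at
    [x^-1]. *)
Lemma count_differences_order3 z g v :
  count_mem (g, v) (differences (lift_order3 z)) =
  ((x^-1 == g)%g * (e0 z * (e1 z)^-1 == v)%g +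
  ((x^-1 == g)%g * (e0 z * e1 z == v)%g +
  ((x == g)%g * (e0 z * (e1 z)^-1 == v^-1)%g + ((1 == g)%g * (e1 z * e1 z == v)%g +
  ((x == g)%g * (e0 z * e1 z == v^-1)%g +
  (1 == g)%g * ((e1 z * e1 z)^-1 == v)%g)))))%N.
Proof.
rewrite count_differences mulgV !mul1g invg1 !mulg1.
by rewrite !eqg_invC !invMg !invgK.
Qed.

(** The first coordinates lie in a Klein four-group, so each involution occurs with two mutually
    inverse second coordinates; for these [R_half] suffices. *)
Lemma count_differences_klein z g v :
  count_mem (g, v) (differences (lift_klein z)) =
  ((ja == g)%g * ((e0 z * e1 z)^-1 == v)%g +
  ((ja * jb == g)%g * ((e0 z * (e1 z)^-1)^-1 == v)%g +
  ((ja == g)%g * (e0 z * e1 z == v)%g + ((jb == g)%g * (e1 z * e1 z == v)%g +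
  ((ja * jb == g)%g * (e0 z * (e1 z)^-1 == v)%g +
  (jb == g)%g * ((e1 z * e1 z)^-1 == v)%g)))))%N.
Proof.
have jabV : (ja * jb)^-1 = ja * jb by rewrite invMg jaV jbV.
have jajab : ja * (ja * jb) = jb by rewrite -{1}jaV mulKg.
have jabja : ja * jb * ja = jb by rewrite cjab -{2}jaV mulgK.
rewrite count_differences jabV jaV jajab jabja invg1 !mul1g !mulg1 !invMg !invgK.
by rewrite !(cW (e1 z)^-1) (cW (e1 z) (e0 z)) (cW (e1 z)).
Qed.

(** The two auxiliary kinds of triples supply six first coordinates: [x], [x^-1], [1] from
    [lift_order3] and [lift_klein]'s companions [ja], [jb], [ja * jb], each once with every
    nontrivial [v]. *)
Lemma count_Delta_lifted g v :
  count_mem (g, v) (Delta (map (@block _) lifted)) =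
  ((v != 1%g) * (count_mem g (Delta (map (@block _) T0)) +
    (x == g) + (x^-1 == g)%g + (1%g == g) + (ja == g) + (jb == g) +
    (ja * jb == g)%g))%N.
Proof.
rewrite (count_Delta _ uniq_lifted) (count_Delta _ U0) big_lifted.
have hD := sum_hits_nontrivial sub_inj subM v.
have hDV := sum_hitsV_nontrivial sub_inj subM v.
have hA := sum_hits_nontrivial add_inj addM v.
have hAV := sum_hitsV_nontrivial add_inj addM v.
have hB := sum_hits_nontrivial dbl_inj dblM v.
have hBV := sum_hitsV_nontrivial dbl_inj dblM v.
have /= kD := sum_hits_half sub_inj subM v R_half.
have /= kA := sum_hits_half add_inj addM v R_half.
have /= kB := sum_hits_half dbl_inj dblM v R_half.
have xv := R_cross v.
have := R_cross v^-1; rewrite invg_eq1 => xvV.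
rewrite (eq_bigr _ (fun z _ => count_differences_order3 z g v)).
rewrite (eq_bigr _ (fun z _ => count_differences_klein z g v)).
(* For a fixed [p] in [T0], [z] runs over all nontrivial elements, so each of the six differences
   takes every nontrivial second coordinate once. *)
under eq_bigr => p _.
  rewrite (eq_bigr _ (fun z _ => count_differences_block p z g v)).
  rewrite !big_split /= -!big_distrr /= hD hDV hA hAV hB hBV.
  rewrite -!mulnDl mulnC.
  over.
rewrite -big_distrr /=.
rewrite !big_split /= -!big_distrr /=.
rewrite big1_eq addn0.
exact: (sum_Delta_arith _ _ _ _ _ _ _ kD kA kB xv xvV).
Qed.

(** The points over [ja] and over [ja * jb] cover complementary halves of the nontrivial elements of
    [W]. Since [ja] and [ja * jb] share a left coset of [<[jb]>], the halves fit together once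
    counts are added over the coset of [g]. *)
Lemma count_Phi_lifted g v : let Phi' := Phi (map (@block _) lifted) in
  (count_mem (g, v) Phi' + count_mem (g * jb, v)%g Phi' =
   (v != 1%g) * (count_mem g (Phi (map (@block _) T0) ++ [:: 1%g; ja; x]) +
     count_mem (g * jb)%g (Phi (map (@block _) T0) ++ [:: 1%g; ja; x])))%N.
Proof.
have h0 := sum_hits_nontrivial e0_inj e0M v.
have h1 := sum_hits_nontrivial e1_inj e1M v.
have h1V := sum_hitsV_nontrivial e1_inj e1M v.
have k0 := sum_hits_half e0_inj e0M v R_half.
have k1 := sum_hits_half e1_inj e1M v R_half.
have cnt h : count_mem (h, v) (Phi (map (@block _) lifted)) =
  ((v != 1%g) * (count_mem h (Phi (map (@block _) T0)) + (1%g == h) + (x == h)) +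
   (ja == h) * (\sum_(z in R) (e1 z == v)) +
   (ja * jb == h)%g * (\sum_(z in R) ((e1 z)^-1 == v)%g))%N.
  rewrite (count_Phi _ uniq_lifted) (count_Phi _ U0) big_lifted.
  rewrite (eq_bigr _ (fun z _ => count_points _ _ _ _ _ _ _ _)).
  rewrite [X in (_ + (_ + X))%N](eq_bigr _ (fun z _ => count_points _ _ _ _ _ _ _ _)).
  under eq_bigr => p _.
    rewrite (eq_bigr _ (fun z _ => count_points _ _ _ _ _ _ _ _)).
    rewrite !big_split /= -!big_distrr /= h0 h1 h1V -!mulnDl mulnC.
    over.
  rewrite -big_distrr /= !big_split /= -!big_distrr /=.
  rewrite big1_eq addn0.
  exact: (sum_Phi_arith _ _ _ _ _ k0 k1).
have jbK y : y * jb * jb = y by rewrite -{2}jbV mulgK.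
have eq_ja : (ja == g * jb) = (ja * jb == g).
  by rewrite -[in LHS](inj_eq (mulIg jb)) jbK.
have eq_jajb : (ja * jb == g * jb) = (ja == g) by rewrite (inj_eq (mulIg jb)).
rewrite /= !cnt !count_cat /= eq_ja eq_jajb.
exact: (coset_Phi_arith _ _ _ _ _ _ _ _ k1).
Qed.

(** * From the counts to the difference family, its resolvability and its multipliers *)

Section Family.
Hypothesis x3 : #[x] = 3.
Hypothesis jbI : jb \in involutions gT.
Hypothesis invE : involutions gT = [set ja; jb; ja * jb].

Let F0 := map (@block _) T0.
Let F := map (@block _) lifted.
Let H : {group gT * W} := setX_group [set: gT]%G [1 W]%G.

Lemma mem_H (y : gT * W) : (y \in H) = (y.2 == 1).
Proof. by case: y => g v; rewrite /H /= in_setX in_setT inE. Qed.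

Lemma mem_cycle3 g : (g \in <[x]>) = (g \in [:: x; x^-1; 1]).
Proof.
have xx : x ^+ 2 = x^-1.
  by apply: (mulgI x); rewrite mulgV -expgS -x3 expg_order.
apply/idP/idP => [/cyclePmin[m]|]; last first.
  by rewrite !inE => /or3P[] /eqP->; rewrite ?group1 ?groupV ?cycle_id.
by rewrite x3 !inE; case: m => [|[|[|//]]] _ ->; rewrite ?xx eqxx ?orbT.
Qed.

(** The union of the members of [pseudo_Sigma x] consists of the six elements added here, and these
    are pairwise distinct. *)
Lemma count_Delta_pseudo g : diff_family (pseudo_Sigma x) F0 ->
  (count_mem g (Delta F0) + (x == g) + (x^-1 == g)%g + (1%g == g) +
     (ja == g) + (jb == g) + (ja * jb == g)%g)%N = 1%N.
Proof.
case=> _ _ /allP perm0.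
have {}perm0 : count_mem g (Delta F0) =
    count_mem g (enum [set g | [forall H in pseudo_Sigma x, g \notin H]]).
  (* Unfolded, [perm_eq] compares counts only at the entries of the two sequences; elsewhere both
     counts are 0. *)
  have [gs|] := boolP (g \in Delta F0 ++
      enum [set g | [forall H in pseudo_Sigma x, g \notin H]]).
    exact/eqP/perm0.
  by rewrite mem_cat negb_or => /andP[/count_memPn-> /count_memPn->].
have xI : x \notin involutions gT by rewrite inE x3.
have xVI : x^-1 \notin involutions gT by rewrite inE orderV x3.
have I1 : 1 \notin involutions gT by rewrite inE order1.
have xxV : x != x^-1.
  by apply/eqP=> /eqP; rewrite eq_sym eq_invg_mul -expg2 -order_dvdn x3.
have mem_inv y : (y \in [:: ja; jb; ja * jb]) = (y \in involutions gT).
  by rewrite invE !inE orbA.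
have Us : uniq ([:: x; x^-1; 1] ++ [:: ja; jb; ja * jb]).
  rewrite cat_uniq; apply/and3P; split.
  - by rewrite /= !inE !negb_or xxV x1 invg_eq1 x1.
  - apply/hasPn=> y; rewrite mem_inv => yI; rewrite !inE; apply/negP.
    by case/or3P=> /eqP y_eq; move: xI xVI I1; rewrite -y_eq yI.
  - rewrite /= !inE negb_or andbT -andbA; apply/and3P; split.
    + by apply: contraNneq jajb1 => ->; rewrite -{2}jbV mulgV.
    + by apply: contraNneq jb1 => eqj; apply/eqP/(mulgI ja); rewrite -eqj mulg1.
    + by apply: contraNneq ja1 => eqj; apply/eqP/(mulIg jb); rewrite -eqj mul1g.
have := count_uniq_mem g Us; rewrite mem_cat -mem_cycle3 mem_inv /= addn0 => cntS.
rewrite -!addnA cntS perm0 (count_uniq_mem _ (enum_uniq _)) mem_enum inE.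
have -> : [forall K in pseudo_Sigma x, g \notin K] =
    ~~ ((g \in <[x]>) || (g \in involutions gT)).
  apply/forall_inP/idP => [allK|]; first rewrite negb_or.
    rewrite (allK <[x]>%G) ?setU11 //=; apply/negP=> gI.
    have /allK : <[g]>%G \in pseudo_Sigma x by rewrite setU1r ?imset_f.
    by rewrite /= cycle_id.
  rewrite negb_or => /andP[gx gI] K /setU1P[->|/imsetP[j jI ->]] //=.
  have /eqP j2 : #[j] == 2 by rewrite inE in jI.
  rewrite cycle2g // !inE negb_or; apply/andP; split.
    by apply: contraNneq gx => ->.
  by apply: contraNneq gI => ->.
by case: (_ || _).
Qed.

Lemma diff_family_lifted :
  diff_family (pseudo_Sigma x) F0 -> diff_family [set H] F.
Proof.
move=> DF0; split.
- by move=> K L; rewrite !inE => /eqP-> /eqP->; rewrite eqxx.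
- by move=> B /mapP[p /uniq_lifted Up ->]; apply: card_block.
apply/allP=> -[g v] _ /=.
rewrite count_Delta_lifted count_Delta_pseudo // muln1.
rewrite (count_uniq_mem _ (enum_uniq _)) mem_enum inE.
apply/eqP; congr nat_of_bool; apply/idP/forall_inP => [v1 K|].
  by rewrite inE => /eqP->; rewrite mem_H.
by move/(_ H); rewrite inE eqxx mem_H; apply.
Qed.

Lemma resolvable_lifted :
    complete_representatives (lcosets <[jb]> [set: gT]) (Phi F0 ++ [:: 1; ja; x]) ->
  exists J : {group gT * W}, [/\ J \subset H, #|J| = 2 & resolvable H J F].
Proof.
case=> _ cosets0; have jb2 : #[jb] = 2 by move: jbI; rewrite inE => /eqP.
pose j : gT * W := (jb, 1).
have jj : j ^+ 2 = 1.
  by rewrite expgS expg1 /j; congr (_, _); rewrite /= ?mulg1 // -{2}jbV mulgV.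
have j2 : #[j] = 2.
  by apply: nt_prime_order => //; rewrite xpair_eqE negb_and jb1.
have jH : <[j]> \subset H by rewrite cycle_subG mem_H.
(* The cosets of [<[j]>] contained in [H] are those with [v = 1], so this one count gives both
   halves of resolvability. *)
have cntC g v : count (mem ((g, v) *: <[j]>)) (Phi F) = (v != 1).
  rewrite count_lcoset2 //= (_ : (g, v) * j = (g * jb, v)); last first.
    by congr (_, _); rewrite /= mulg1.
  rewrite count_Phi_lifted -count_lcoset2 // cosets0 ?muln1 //.
  by apply/lcosetsP; exists g; rewrite ?inE.
exists <[j]>%G; split=> //; split.
  case=> g v gv; apply/bigcupP; exists ((g, v) *: <[j]>); last exact: lcoset_refl.
  rewrite inE; apply/andP; split; first by apply/lcosetsP; exists (g, v).
  (* A coset inside [H] is met 0 times, so no point of a block lies in [H]. *)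
  apply/negP=> /subsetP/(_ _ (lcoset_refl _ _)); rewrite mem_H /= => v1.
  have := cntC g v; rewrite v1 => /eqP; apply/negP; rewrite -lt0n -has_count.
  by apply/hasP; exists (g, v) => //=; apply: lcoset_refl.
move=> C; rewrite inE => /andP[/lcosetsP[[g v] _ ->] CH].
rewrite cntC; case: eqVneq => // v1; case/negP: CH; apply/subsetP=> y.
by rewrite mem_lcoset => /(subsetP jH); rewrite !mem_H v1 /= invg1 mul1g.
Qed.

(** As [f] commutes with [e0], [e1] and inversion, it carries the block of parameter [z] to the
    block of the same kind of parameter [f z]. *)
Lemma strong_multiplier_lift (f : W -> W) (a : {perm gT * W}) :
    injective f -> {morph f : u v / u * v} ->
    (forall z, f (e0 z) = e0 (f z)) -> (forall z, f (e1 z) = e1 (f z)) ->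
    (forall z, z \in R -> f z \in R) -> (forall y, a y = (y.1, f y.2)) ->
  strong_multiplier H F a.
Proof.
move=> f_inj fM fe0 fe1 fR aE.
have fV := morphV fM.
have block_a p : a @: block p = block (a p.1.1, a p.1.2, a p.2).
  apply/setP=> y; apply/imsetP/idP => [[z + ->]|]; rewrite !inE.
    by case/or3P=> /eqP->; rewrite eqxx ?orbT.
  by case/or3P=> /eqP->; [exists p.1.1 | exists p.1.2 | exists p.2];
     rewrite // !inE eqxx ?orbT.
split.
- rewrite inE; apply/andP; split; first by apply/subsetP=> y; rewrite inE.
  apply/morphicP=> -[g v] [h w] _ _; rewrite !aE /=.
  by congr (_, _); apply: fM.
- by case=> g v; rewrite mem_H => /= /eqP ->; rewrite aE /= (eqP (_ : f 1 == 1)) ?morph_eq1.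
(* Taking images under a permutation is injective on sets, so inclusion of the images in the family
   is enough. *)
apply/eqP; rewrite eqEcard card_imset; last exact/imset_inj/perm_inj.
rewrite cardsE leqnn andbT; apply/subsetP=> _ /imsetP[B + ->].
rewrite !inE => /mapP[p + ->]; rewrite block_a => pT; apply: map_f.
move: pT; rewrite !mem_cat => /or3P[/allpairsP[[q z] [/= qT + ->]]||].
- rewrite mem_enum !inE -(morph_eq1 f_inj fM) => fz1.
  apply/orP; left; apply/allpairsP; exists (q, f z); split=> //=.
    by rewrite mem_enum !inE.
  by rewrite !aE /lift_block /= fV fe0 fe1.
- case/mapP=> z; rewrite mem_enum => zR ->; apply/or3P/Or32/mapP.
  exists (f z); first by rewrite mem_enum fR.
  by rewrite !aE /lift_order3 /= fV fe0 fe1.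
- case/mapP=> z; rewrite mem_enum => zR ->; apply/or3P/Or33/mapP.
  exists (f z); first by rewrite mem_enum fR.
  by rewrite !aE /lift_klein /= !fV fe0 fe1.
Qed.

End Family.
End Lift.

(** * Squares in a finite field of order congruent to 3 modulo 4 *)

Section HalfField.
Variable K : finFieldType.
Hypothesis q3 : #|K| %% 4 = 3.
Implicit Types y z s : K.
Local Open Scope ring_scope.

(* The nonzero squares of K, by Euler's criterion. *)
Definition nzsquares : {set K} := [set y | y ^+ #|K|./2 == 1].

Lemma cardK : #|K| = (#|K|./2).*2.+1.
Proof. lia. Qed.

(** By Euler's criterion this says that -1 is not a square. *)
Lemma odd_halfK : odd #|K|./2.
Proof. lia. Qed.

Lemma two_neq0 : 2%:R != 0 :> K.
Proof.
(* The additive group has order [#|K|], which is odd; so 2 = 0 would force 1 = 0. *)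
have K0 : 1 *+ #|K| = 0 :> K.
  by rewrite -FinRing.zmodXgE -cardsT; apply: (expg_cardG (in_setT (1 : K))).
apply: contra_eq_neq K0 => two0.
by rewrite cardK mulrS -muln2 mulnC mulrnA two0 mul0rn addr0 oner_neq0.
Qed.

Lemma nzsquares0 : 0 \notin nzsquares.
Proof.
by rewrite inE expr0n eq_sym; case: #|K|./2 odd_halfK => //= *; rewrite oner_neq0.
Qed.

Lemma nzsquares1 : 1 \in nzsquares.
Proof. by rewrite inE expr1n. Qed.

Lemma nzsquares_neq0 y : y \in nzsquares -> y != 0.
Proof. by apply: contraTneq => ->; rewrite nzsquares0. Qed.

Lemma nzsquaresM y z : y \in nzsquares -> (y * z \in nzsquares) = (z \in nzsquares).
Proof. by rewrite !inE exprMn => /eqP->; rewrite mul1r. Qed.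

Lemma sqr_nzsquares y : y != 0 -> y ^+ 2 \in nzsquares.
Proof.
move=> y0; rewrite inE -exprM mulnC muln2; apply/eqP/(mulfI y0).
by rewrite mulr1 -exprS -cardK expf_card.
Qed.

Lemma nzsquares_half y : y != 0 ->
  ((y \in nzsquares) + (- y \in nzsquares) = 1)%N.
Proof.
move=> y0; have := sqr_nzsquares y0.
rewrite !inE exprAC sqrf_eq1 exprNn -signr_odd odd_halfK expr1 mulN1r.
have neq1 : (1 : K) != -1.
  by apply: contraNneq two_neq0 => one; rewrite mulr2n {2}one subrr.
by case/orP=> /eqP->; rewrite ?opprK eqxx ?(negbTE neq1) // eq_sym (negbTE neq1).
Qed.

(** Negation exchanges squares and nonsquares among the nonzero elements, so each kind makes up half
    of them. *)
Lemma card_nzsquares : #|nzsquares| = #|K|./2.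
Proof.
have : (\sum_(y : K | y != 0%R) ((y \in nzsquares) + (- y \in nzsquares)) = #|K|.-1)%N.
  by rewrite (eq_bigr _ nzsquares_half) sum1_card -(cardC1 (0 : K)).
rewrite big_split /= [X in (_ + X)%N](reindex_inj oppr_inj) /=.
rewrite [X in (_ + X)%N](eq_bigl (fun y => y != 0)) => [|y]; last first.
  by rewrite oppr_eq0.
under [X in (_ + X)%N]eq_bigr => y _ do rewrite opprK.
suff -> : (\sum_(y : K | y != 0%R) (y \in nzsquares))%N = #|nzsquares|.
  by rewrite addnn {1}cardK => /double_inj.
rewrite -sum1_card big_mkcond [RHS]big_mkcond /=; apply: eq_bigr => y _.
by case: eqVneq => [->|_]; [rewrite (negbTE nzsquares0) | case: (_ \in _)].
Qed.

(** An order congruent to 3 modulo 4 and different from 3 exceeds 3, so some element avoids the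
    three values. *)
Lemma exists_generic : #|K| != 3 -> exists s, [&& s != 0, s != 1 & s != -1].
Proof.
move=> neq3; apply/existsP; apply: contraT; rewrite negb_exists => /forallP none.
have : (#|[set: K]| <= #|[set 0; 1; -1 : K]%R|)%N.
  apply/subset_leq_card/subsetP=> y _; have := none y.
  by rewrite !inE !negb_and !negbK orbA.
rewrite cardsT => /leq_trans/(_ (leq_card_setU _ _)).
rewrite cards1 => /leq_trans/(_ (leq_add (leq_card_setU _ _) (leqnn 1))).
by rewrite !cards1; move: q3 neq3; case: #|K| => [|[|[|[|]]]].
Qed.

(** Otherwise [s ^+ 2 = -1], making -1 a square. *)
Lemma generic_neq0 s : s != 0 -> s + s^-1 != 0.
Proof.
move=> s0; apply/eqP=> s1.
have : s ^+ 2 = -1.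
  by apply/eqP; rewrite -addr_eq0 -(mulr0 s) -s1 mulrDr divff // expr2.
move=> s2; have := sqr_nzsquares s0; rewrite s2 => N1.
by have := nzsquares_half (oner_neq0 K); rewrite N1 nzsquares1.
Qed.

Lemma add_generic_neq0 s : s != 0 -> s != -1 -> 2%:R + (s + s^-1) != 0.
Proof.
move=> s0 sN1.
have -> : 2%:R + (s + s^-1) = (s + 1) ^+ 2 / s by field.
by rewrite mulf_neq0 ?invr_eq0 ?expf_neq0 // addr_eq0.
Qed.

Lemma sub_generic_neq0 s : s != 0 -> s != 1 -> 2%:R - (s + s^-1) != 0.
Proof.
move=> s0 s1.
have -> : 2%:R - (s + s^-1) = - ((s - 1) ^+ 2 / s) by field.
by rewrite oppr_eq0 mulf_neq0 ?invr_eq0 ?expf_neq0 // subr_eq0.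
Qed.

Lemma generic_cross s : s != 0 -> s != 1 ->
  2%:R + (s + s^-1) = - ((2%:R - (s + s^-1)) * ((s + 1) / (s - 1)) ^+ 2).
Proof. by move=> s0 s1; field; rewrite s0 subr_eq0 s1. Qed.

Lemma generic_square s : s != 1 -> s != -1 ->
  ((s + 1) / (s - 1)) ^+ 2 \in nzsquares.
Proof.
move=> s1 sN1; rewrite sqr_nzsquares // mulf_neq0 ?invr_eq0 ?subr_eq0 //.
by rewrite addr_eq0.
Qed.

End HalfField.

Lemma greatest_odd_divisor_pow2M k M : odd M ->
  greatest_odd_divisor (2 ^ k * M)%N = M.
Proof.
move=> oddM; have M0 : (0 < M)%N by exact: odd_gt0.
apply/eqP; rewrite eqn_leq; apply/andP; split.
  apply/bigmax_leqP_seq => d; rewrite -dvdn_divisors ?muln_gt0 ?expn_gt0 // => dM oddd.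
  by rewrite dvdn_leq // -(@Gauss_dvdr _ (2 ^ k)%N) // coprimeXr // coprimen2.
apply: (@leq_bigmax_seq _ _ _ id) => //.
by rewrite -dvdn_divisors ?muln_gt0 ?expn_gt0 // dvdn_mull.
Qed.

(** * The product of the component fields, its square units and the half [R] *)

Section ProductOfFields.
Variable n : nat.
Hypothesis comp3 : forall i : 'I_(size (primes n)), #|comp_field i| %% 4 = 3.
Implicit Types (c d u v w z : V n) (i k : 'I_(size (primes n))).

Lemma V_mulE v w i : (v * w) i = (v i + w i)%R.
Proof. by rewrite ffunE. Qed.

Lemma V_invE v i : v^-1 i = (- v i)%R.
Proof. by rewrite ffunE. Qed.

Lemma V_oneE i : (1 : V n) i = 0%R.
Proof. by rewrite ffunE. Qed.

Lemma V_mulC v w : v * w = w * v.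
Proof. by apply/ffunP=> i; rewrite !V_mulE addrC. Qed.

Definition scale c z : V n := [ffun i => (c i * z i)%R].

Lemma scaleE c z i : scale c z i = (c i * z i)%R.
Proof. by rewrite ffunE. Qed.

Lemma scaleM c : {morph scale c : v w / v * w}.
Proof. by move=> v w; apply/ffunP=> i; rewrite !(scaleE, V_mulE) mulrDr. Qed.

Lemma scale_inj c : (forall i, c i != 0%R) -> injective (scale c).
Proof.
move=> c0 v w /ffunP eq_vw; apply/ffunP=> i; apply: (mulfI (c0 i)).
by have := eq_vw i; rewrite !scaleE.
Qed.

Lemma scaleC c d z : scale c (scale d z) = scale d (scale c z).
Proof. by apply/ffunP=> i; rewrite !scaleE mulrCA. Qed.

Definition square_units : {set V n} :=
  setXn (fun i => nzsquares (comp_field i)).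

Lemma square_unitsP u :
  reflect (forall i, u i \in nzsquares (comp_field i)) (u \in square_units).
Proof. exact: setXnP. Qed.

Lemma square_units_neq0 u i : u \in square_units -> u i != 0%R.
Proof. by move/square_unitsP/(_ i)/(nzsquares_neq0 (comp3 i)). Qed.

(** The set [R] of the construction, in effect a set of positive elements for a lexicographic order
    of the coordinates, with squares playing the role of positive numbers. *)
Definition half_space : {set V n} :=
  [set z : V n | [exists i : 'I_(size (primes n)),
    [forall k : 'I_(size (primes n)), (k < i)%N ==> (z k == 0%R)]
    && (z i \in nzsquares (comp_field i))]].

Lemma scale_half_space u z :
  u \in square_units -> (scale u z \in half_space) = (z \in half_space).
Proof.
move=> uS; rewrite !inE; apply: eq_existsb => i; rewrite scaleE.
rewrite nzsquaresM ?(square_unitsP _ uS) //; congr (_ && _).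
apply: eq_forallb => k.
by rewrite scaleE mulf_eq0 (negbTE (square_units_neq0 k uS)).
Qed.

Lemma mem_half_space z i : (forall k, (k < i)%N -> z k = 0%R) -> z i != 0%R ->
  (z \in half_space) = (z i \in nzsquares (comp_field i)).
Proof.
move=> z_lt zi; rewrite inE; apply/existsP/idP => [[k /andP[/forallP k_lt zk]]|ziS].
  have [lt_ki|lt_ik|/val_inj <- //] := ltngtP k i.
    by have := nzsquares_neq0 (comp3 k) zk; rewrite z_lt ?eqxx.
  by have := k_lt i; rewrite lt_ik (negbTE zi).
exists i; rewrite ziS andbT; apply/forallP=> k; apply/implyP=> /z_lt ->.
exact: eqxx.
Qed.

Lemma half_spaceP v :
  ((v \in half_space) + (v^-1 \in half_space) = (v != 1%g))%N.
Proof.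
have [->|v1] := eqVneq v 1.
  rewrite invg1 inE; case: existsP => // -[i /andP[_]].
  by rewrite V_oneE (negbTE (nzsquares0 (comp3 i))).
have [i0 vi0] : exists i, v i != 0%R.
  apply/existsP; apply: contraNT v1; rewrite negb_exists => /forallP v0.
  by apply/eqP/ffunP=> i; rewrite V_oneE; apply/eqP/negPn.
(* At the first nonzero coordinate of [v], which is also that of its opposite, the question reduces
   to one field. *)
case: (@arg_minnP _ i0 (fun i => v i != 0%R) (fun i => i : nat) vi0) => i vi min_i.
have v_lt k : (k < i)%N -> v k = 0%R.
  by move=> lt_ki; apply/eqP; apply: contraLR lt_ki => /min_i; rewrite -leqNgt.
rewrite (mem_half_space v_lt vi) (@mem_half_space v^-1 i).
- by rewrite V_invE nzsquares_half.
- by move=> k /v_lt; rewrite V_invE => ->; rewrite oppr0.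
- by rewrite V_invE oppr_eq0.
Qed.

(** Each [q - 1] is twice the number of nonzero squares of its field, and that number is odd; the
    product of these numbers is thus the odd part of [psi n]. *)
Lemma card_square_units : #|square_units| = greatest_odd_divisor (psi n).
Proof.
rewrite cardsXn.
have -> : psi n = (2 ^ size (primes n) *
    \prod_(i < size (primes n)) #|nzsquares (comp_field i)|)%N.
  rewrite /psi /components big_map (big_nth 0%N) big_mkord.
  rewrite -[X in (2 ^ X)%N](card_ord (size (primes n))) -prod_nat_const.
  rewrite -big_split /=; apply: eq_bigr => i _.
  rewrite -/(comp_prime i) -card_comp_field card_nzsquares // mul2n.
  by rewrite {1}(cardK (comp3 i)) subn1.
rewrite greatest_odd_divisor_pow2M //.
apply: (big_ind (fun m => odd m)) => // [m k om ok|i _].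
  by rewrite oddM om.
by rewrite card_nzsquares // odd_halfK.
Qed.

(** * The group of multiplications by square units *)

Section Multipliers.
Variable gT : finGroupType.

Lemma scale_pair_inj c : (forall i, c i != 0%R) ->
  injective (fun y : gT * V n => (y.1, scale c y.2)).
Proof.
by move=> c0 [g v] [h w] /= [-> vw]; rewrite (scale_inj c0 vw).
Qed.

(* The identity when c is not invertible. *)
Definition mult_fun c (y : gT * V n) : gT * V n :=
  if [forall i, c i != 0%R] then (y.1, scale c y.2) else y.

Lemma mult_fun_inj c : injective (mult_fun c).
Proof.
move=> y1 y2; rewrite /mult_fun; case: ifP => [/forallP c0|//].
exact: (scale_pair_inj c0).
Qed.

Definition mult_perm c : {perm gT * V n} := perm (@mult_fun_inj c).

Lemma mult_permE u y : u \in square_units -> mult_perm u y = (y.1, scale u y.2).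
Proof.
move=> uS; rewrite permE /mult_fun ifT //.
by apply/forallP=> i; apply: square_units_neq0.
Qed.

Definition multipliers : {set {perm gT * V n}} := mult_perm @: square_units.

Lemma group_set_multipliers : group_set multipliers.
Proof.
apply/group_setP; split.
  apply/imsetP; exists [ffun=> 1%R].
    by apply/square_unitsP=> i; rewrite ffunE nzsquares1.
  apply/permP=> -[g v]; rewrite perm1 mult_permE; last first.
    by apply/square_unitsP=> i; rewrite ffunE nzsquares1.
  by congr (_, _); apply/ffunP=> i; rewrite scaleE ffunE mul1r.
move=> _ _ /imsetP[u uS ->] /imsetP[w wS ->]; apply/imsetP.
have uwS : scale u w \in square_units.
  apply/square_unitsP=> i.
  by rewrite scaleE nzsquaresM // (square_unitsP _ uS, square_unitsP _ wS).
exists (scale u w) => //; apply/permP=> -[g v].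
rewrite permM !mult_permE //=; congr (_, _); apply/ffunP=> i.
by rewrite !scaleE mulrA (mulrC (w i)).
Qed.

Lemma card_multipliers : #|multipliers| = #|square_units|.
Proof.
(* The unit [u] is recovered as the image of the vector of ones. *)
apply: card_in_imset => u w uS wS /permP/(_ (1, [ffun=> 1%R])).
rewrite !mult_permE // => -[/ffunP eq_uw]; apply/ffunP=> i.
by have := eq_uw i; rewrite !scaleE !ffunE !mulr1.
Qed.

End Multipliers.

(** * The scalings by 2 and by [c = s + 1/s], and their sum and difference *)

Section Generic.
Variable s : V n.
Hypotheses (s0 : forall i, s i != 0%R) (s1 : forall i, s i != 1%R).
Hypothesis sN1 : forall i, s i != (-1)%R.

Definition two : V n := [ffun=> 2%:R%R].
Definition generic : V n := [ffun i => (s i + (s i)^-1)%R].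

Lemma scale_two_inj : injective (scale two).
Proof. by apply: scale_inj => i; rewrite ffunE two_neq0. Qed.

Lemma scale_generic_inj : injective (scale generic).
Proof. by apply: scale_inj => i; rewrite ffunE; exact: (generic_neq0 (comp3 i) (s0 i)). Qed.

Lemma add_injective : injective (fun z => scale two z * scale generic z).
Proof.
apply: (@eq_inj _ _ (scale (two * generic))) => [|z].
  apply: scale_inj => i; rewrite V_mulE !ffunE.
  exact: (add_generic_neq0 (s0 i) (sN1 i)).
by apply/ffunP=> i; rewrite V_mulE !scaleE V_mulE mulrDl.
Qed.

Lemma sub_injective : injective (fun z => scale two z * (scale generic z)^-1).
Proof.
apply: (@eq_inj _ _ (scale (two * generic^-1))) => [|z].
  apply: scale_inj => i; rewrite V_mulE V_invE !ffunE.
  exact: (sub_generic_neq0 (s0 i) (s1 i)).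
by apply/ffunP=> i; rewrite V_mulE V_invE !scaleE V_mulE V_invE mulrDl mulNr.
Qed.

Lemma dbl_injective : injective (fun z => scale generic z * scale generic z).
Proof.
apply: (@eq_inj _ _ (scale (generic * generic))) => [|z].
  apply: scale_inj => i; rewrite V_mulE !ffunE -mulr2n -mulr_natl mulf_neq0 //.
    exact: two_neq0.
  exact: (generic_neq0 (comp3 i) (s0 i)).
by apply/ffunP=> i; rewrite V_mulE !scaleE V_mulE mulrDl.
Qed.

(* 2 + c and - (2 - c) differ by the square of (s + 1) / (s - 1) when
   c = s + s^-1. *)
Lemma half_space_cross v :
  (\sum_(z in half_space) (scale two z * (scale generic z)^-1 == v)%g +
   \sum_(z in half_space) (scale two z * scale generic z == v)%g =
   (v != 1%g))%N.
Proof.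
rewrite (sum_hits sub_injective) (sum_hits add_injective).
have addE := f_invF add_injective v; have subE := f_invF sub_injective v.
have w1 := morph_eq1 add_injective (addM V_mulC (@scaleM _) (@scaleM _)).
move: (invF add_injective v) (invF sub_injective v) addE subE => w w' wE w'E.
pose t : V n := [ffun i => (((s i + 1) / (s i - 1)) ^+ 2)%R].
have tS : t \in square_units.
  apply/square_unitsP=> i; rewrite ffunE.
  exact: (generic_square (comp3 i) (s1 i) (sN1 i)).
(* From [(2 + c) w = v = (2 - c) w'] and [2 + c = - t (2 - c)] it follows that [w' = - t w], and [t]
   is a square unit. *)
have -> : w' = scale t w^-1.
  apply: sub_injective; rewrite /= w'E -wE; apply/ffunP=> i.
  rewrite !V_mulE V_invE !scaleE V_invE /two /generic /t !ffunE -!mulrDl.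
  rewrite (generic_cross (s0 i) (s1 i)).
  by rewrite -mulrBl !(mulrN, mulNr) mulrA.
rewrite scale_half_space // addnC half_spaceP; congr (nat_of_bool (~~ _)).
by rewrite -wE w1.
Qed.

End Generic.
End ProductOfFields.

(** * The difference family over the product of [gT] and [V n] *)

Theorem theorem8p3 (n : nat) (gT : finGroupType) :
  (1 < n)%N ->
  (forall q, q \in components n -> q = 3 %[mod 4] /\ q <> 3) ->
  pertinent gT ->
  4 %| #|gT| ->
  (exists (x : gT) (F0 : seq {set gT}),
    [/\ #[x] = 3, diff_family (pseudo_Sigma x) F0 & pseudo_resolvable x F0]) ->
  let H : {group gT * V n} := setX_group [set: gT]%G [1 V n]%G in
  exists F : seq {set gT * V n},
    [/\ diff_family [set H] F,
        exists J : {group gT * V n},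
          [/\ J \subset H, #|J| = 2 & resolvable H J F]
      & exists A : {group {perm gT * V n}},
          #|A| = greatest_odd_divisor (psi n) /\
          (forall a, a \in A -> strong_multiplier H F a)].
Proof.
move=> _ compP pG dvd4 [x [F0 [x3 DF0 [ja [jb [jaI jbI reps]]]]]] H.
have [T0 defF0 U0] : exists2 T : seq (gT * gT * gT),
    F0 = map (@block _) T & {in T, forall p, uniq (points p)}.
  by apply: block_family; case: DF0.
have compF (i : 'I_(size (primes n))) :
    #|comp_field i| %% 4 = 3 /\ #|comp_field i| <> 3.
  by rewrite card_comp_field; apply: compP; apply/map_f/mem_nth.
have comp3 i := (compF i).1.
have generic_i (i : 'I_(size (primes n))) :
    exists t : comp_field i, [&& t != 0%R, t != 1%R & t != (-1)%R].
  by apply: exists_generic => //; apply/eqP; case: (compF i).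
have [s sP] := fin_all_exists generic_i.
pose sV : V n := [ffun i => s i].
have s0 i : sV i != 0%R by rewrite ffunE; case/and3P: (sP i).
have s1 i : sV i != 1%R by rewrite ffunE; case/and3P: (sP i).
have sN1 i : sV i != (-1)%R by rewrite ffunE; case/and3P: (sP i).
have jb2 : #[jb] = 2 by apply/eqP; move: jbI; rewrite inE.
have [ja1 jb1] : ja != 1 /\ jb != 1.
  by case/involutionP: jaI => ? _; case/involutionP: jbI.
have neq_jab : ja != jb.
  (* If [ja = jb], the coset [<[jb]>] would contain both representatives [1] and [ja]. *)
  apply/eqP=> eqj.
  have /reps.2 : 1 *: <[jb]> \in lcosets <[jb]> [set: gT].
    by apply/lcosetsP; exists 1; rewrite ?inE.
  rewrite count_lcoset2 // mul1g !count_cat /= eqj !eqxx; lia.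
have [cjab jabI invE] := pertinent_involutions pG dvd4 jaI jbI neq_jab.
have jab1 : ja * jb != 1 by case/involutionP: jabI.
have jaV := involution_inv jaI; have jbV := involution_inv jbI.
have x1 : x != 1 by rewrite -order_eq1 x3.
pose e0 := scale (two n); pose e1 := scale (generic sV).
pose R := half_space n.
have cV := @V_mulC n.
have e0M : {morph e0 : u v / u * v} := @scaleM n _.
have e1M : {morph e1 : u v / u * v} := @scaleM n _.
have e0_inj : injective e0 := scale_two_inj comp3.
have e1_inj : injective e1 := scale_generic_inj comp3 s0.
have add_inj : injective (fun z => e0 z * e1 z) := add_injective s0 sN1.
have sub_inj : injective (fun z => e0 z * (e1 z)^-1) := sub_injective s0 s1.
have dbl_inj : injective (fun z => e1 z * e1 z) := dbl_injective comp3 s0.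
have R_half := half_spaceP comp3.
have R_cross := half_space_cross comp3 s0 s1 sN1.
rewrite defF0 in DF0 reps.
exists (map (@block _) (lifted T0 x ja jb R e0 e1)); split.
- exact: diff_family_lifted.
- exact: resolvable_lifted.
exists (Group (group_set_multipliers comp3 gT)); split.
  by rewrite /= card_multipliers // card_square_units.
move=> _ /imsetP[u uS ->]; apply: (@strong_multiplier_lift _ _ _ _ _ _ _ _ _ (scale u)).
- by apply: scale_inj => i; apply: square_units_neq0.
- exact: scaleM.
- by move=> z; rewrite /e0 scaleC.
- by move=> z; rewrite /e1 scaleC.
- by move=> z; rewrite scale_half_space.
- by move=> y; rewrite mult_permE.
Qed.
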